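(* Let $\Delta$ be fixed, and let $\mathcal{H}=(\mathcal{V},\mathcal{E})$ be a 3-uniform hypergraph with $n=|\mathcal{V}|$ vertices and maximum degree $\Delta$. If $q\ge\left\lceil\tfrac32\Delta+1\right\rceil$, then the Markov chain $\mathcal{C}(\mathcal{H})$ (Glauber dynamics on the proper $q$-colourings of $\mathcal{H}$) has mixing time $O(n\log n)$.
   Context: A colouring of the vertices of $\mathcal{H}$ with colours $\{1,\dots,q\}$ is proper if no edge is monochromatic; $\Omega'(\mathcal{H})$ is the set of all proper $q$-colourings. 3-uniform means that every edge has exactly 3 vertices. The Markov chain $\mathcal{C}(\mathcal{H})$ has state space $\Omega'(\mathcal{H})$ and the following transitions. If the state at time $t$ is $X_t$: select a vertex $v\in\mathcal{V}$ and a colour $k\in\{1,\dots,q\}$ uniformly at random; let $X'_t$ be the colouring obtained from $X_t$ by recolouring $v$ with colour $k$; if $X'_t$ is proper let $X_{t+1}=X'_t$, otherwise let $X_{t+1}=X_t$. Its stationary distribution is uniform on $\Omega'(\mathcal{H})$. The mixing time $\tau(\varepsilon)$ is the least $t$ such that, from every starting state, the law of the chain at every time $t'\ge t$ is within total variation distance $\varepsilon$ of the stationary distribution. The $O(\cdot)$ is as $n\to\infty$, with $\Delta$ and the accuracy $\varepsilon\in(0,1)$ fixed. *)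

(* Defs.v *)
From HB Require Import structures.
From mathcomp Require Import all_boot all_order all_algebra.
From mathcomp Require Import all_classical all_reals all_analysis.

Set Implicit Arguments.
Unset Strict Implicit.
Unset Printing Implicit Defensive.

Import Order.TTheory GRing.Theory Num.Theory.

Local Open Scope ring_scope.

Definition uniform_hypergraph (k : nat) (V : finType) (E : {set {set V}}) : Prop :=
  forall e : {set V}, e \in E -> #|e| = k.

Definition degree (V : finType) (E : {set {set V}}) (v : V) : nat :=
  #|[set e in E | v \in e]|.

Definition max_degree (V : finType) (E : {set {set V}}) : nat :=
  \max_(v : V) degree E v.

Definition monochromatic (V : finType) (q : nat)
    (x : {ffun V -> 'I_q}) (e : {set V}) : bool :=
  [exists k : 'I_q, [forall v in e, x v == k]].

Definition proper (V : finType) (E : {set {set V}}) (q : nat)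
    (x : {ffun V -> 'I_q}) : bool :=
  [forall e in E, ~~ monochromatic x e].

Notation proper_colouring E q := {x : {ffun _ -> 'I_q} | proper E x}.

(* [P x y] is the probability of moving from [x] to [y]. *)

Definition stochastic (R : realType) (T : finType) (P : T -> T -> R) : Prop :=
  (forall x y : T, 0 <= P x y) /\ (forall x : T, \sum_(y : T) P x y = 1).

Definition next_law (R : realType) (T : finType) (P : T -> T -> R)
    (mu : T -> R) : T -> R :=
  fun y => \sum_(x : T) mu x * P x y.

Definition law (R : realType) (T : finType) (P : T -> T -> R)
    (x0 : T) (t : nat) : T -> R :=
  iter t (next_law P) (fun x => (x == x0)%:R).

Definition uniform_law (R : realType) (T : finType) : T -> R :=
  fun _ => #|T|%:R^-1.

Definition stationary (R : realType) (T : finType) (P : T -> T -> R)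
    (pi : T -> R) : Prop :=
  forall y : T, next_law P pi y = pi y.

Definition tv_dist (R : realType) (T : finType) (mu nu : T -> R) : R :=
  2^-1 * \sum_(x : T) `|mu x - nu x|.

Definition mixed_from (R : realType) (T : finType) (P : T -> T -> R)
    (pi : T -> R) (eps : R) (t : nat) : Prop :=
  forall (x0 : T) (t' : nat), (t <= t')%N -> tv_dist (law P x0 t') pi <= eps.

Definition is_mixing_time (R : realType) (T : finType) (P : T -> T -> R)
    (pi : T -> R) (eps : R) (tau : nat) : Prop :=
  mixed_from P pi eps tau /\
  forall t : nat, mixed_from P pi eps t -> (tau <= t)%N.

Definition recolour (V : finType) (q : nat) (x : {ffun V -> 'I_q})
    (v : V) (k : 'I_q) : {ffun V -> 'I_q} :=
  [ffun u => if u == v then k else x u].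

(* [insubd x y] is [y] if [y] is proper and [x] otherwise. *)
Definition glauber_move (V : finType) (E : {set {set V}}) (q : nat)
    (x : proper_colouring E q) (v : V) (k : 'I_q) : proper_colouring E q :=
  insubd x (recolour (val x) v k).

Definition glauber (R : realType) (V : finType) (E : {set {set V}}) (q : nat)
    (x y : proper_colouring E q) : R :=
  \sum_(v : V) \sum_(k : 'I_q)
    #|V|%:R^-1 * q%:R^-1 * (glauber_move x v k == y)%:R.

Lemma glauber_stochastic (R : realType) (V : finType) (E : {set {set V}})
    (q : nat) : (0 < #|V|)%N -> (0 < q)%N ->
  stochastic (@glauber R V E q).
Proof.
move=> V0 q0; split=> [x y|x].
  by apply: sumr_ge0 => v _; apply: sumr_ge0 => k _; rewrite !mulr_ge0 ?invr_ge0.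
rewrite /glauber exchange_big /=.
under eq_bigr => v _.
  rewrite exchange_big /=.
  under eq_bigr => k _.
    rewrite -mulr_sumr (bigD1 (glauber_move x v k)) //= eqxx big1; last first.
      by move=> y /negbTE; rewrite eq_sym => ->.
    rewrite addr0 mulr1; over.
  rewrite sumr_const card_ord -[(_ * _) *+ _]mulr_natr mulfVK ?pnatr_eq0 -?lt0n //; over.
by rewrite sumr_const -[_^-1 *+ _]mulr_natr mulVf // pnatr_eq0 -lt0n.
Qed.

Lemma glauber_sym (R : realType) (V : finType) (E : {set {set V}}) (q : nat)
    (x y : proper_colouring E q) : glauber R x y = glauber R y x.
Proof.
have [->//|neq_xy] := eqVneq x y.
have neq_yx : y != x by rewrite eq_sym.
have moveE (a b : proper_colouring E q) v k : a != b ->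
    (glauber_move a v k == b) =
    (k == val b v) && [forall u, (u != v) ==> (val a u == val b u)].
  move=> neq_ab; apply/eqP/andP => [ab|[/eqP -> /forallP ab]].
    have vb : val b = recolour (val a) v k.
      move: ab; rewrite /glauber_move /insubd.
      by case: insubP => [c _ <- /= ->//|_ /= abs]; rewrite abs eqxx in neq_ab.
    rewrite vb ffunE !eqxx; split=> //; apply/forallP => u; apply/implyP.
    by rewrite ffunE => /negbTE ->.
  apply: val_inj.
  have e : recolour (val a) v (val b v) = val b.
    apply/ffunP => u; rewrite ffunE; case: eqVneq => [->//|uv].
    by have := ab u; rewrite uv => /eqP.
  by rewrite /glauber_move e val_insubd (valP b).
apply: eq_bigr => v _; rewrite -!mulr_sumr; congr (_ * _).
under eq_bigr do rewrite moveE //.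
under [RHS]eq_bigr do rewrite moveE //.
rewrite (bigD1 (val y v)) //= [RHS](bigD1 (val x v)) //= !eqxx /=.
rewrite !big1 ?addr0; first last.
- by move=> k /negbTE ->.
- by move=> k /negbTE ->.
congr (_%:R); congr (nat_of_bool _).
by apply: eq_forallb => u; rewrite (eq_sym (val x u)).
Qed.

Lemma glauber_stationary (R : realType) (V : finType) (E : {set {set V}})
    (q : nat) : (0 < #|V|)%N -> (0 < q)%N ->
  stationary (@glauber R V E q) (@uniform_law R (proper_colouring E q)).
Proof.
move=> V0 q0 y; rewrite /next_law /uniform_law -mulr_sumr.
under eq_bigr do rewrite glauber_sym.
by rewrite (glauber_stochastic R E V0 q0).2 mulr1.
Qed.

(* Main.v *)
Require Import Defs.
From mathcomp Require Import all_boot all_order all_algebra.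
From mathcomp Require Import all_classical all_reals all_analysis.
From mathcomp Require Import finset zify ring lra.

Set Implicit Arguments.
Unset Strict Implicit.
Unset Printing Implicit Defensive.

Import Order.TTheory GRing.Theory Num.Theory.

Local Open Scope ring_scope.

(** Path coupling with a weighted metric.

    Extend the chain to all colourings: a move that recolours [v] with [k] is
    refused exactly when [k] is blocked at [v], that is, when some edge through
    [v] would become monochromatic.  On proper colourings this is the Glauber
    dynamics, and in the larger space any two colourings are joined by at most
    [n] single-vertex changes.

    Let [x] and [y] differ at [w] only, with colours [a] and [b], and let both
    make the same move (v, k).  A move at [w] removes the disagreement unless
    [k] is blocked there.  A move at [u != w] creates a second disagreement only
    if [k] is [a] or [b] and some edge {w, u, v} has [v] coloured [k].  An edge
    {w, u, v} whose vertices [u] and [v] are coloured [a] and [b] offers two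
    such bad moves, so the plain Hamming distance would need q > 2 Delta.
    Such an edge is short-lived, however: [u] and [v] have at least
    q - Delta - 1 unblocked colours outside {a, b} each.  The distance of [x]
    and [y] is therefore taken to be a constant plus, for each edge {w, u, v},
    the number of vertices among [u] and [v] that have colour [a] or [b]; an
    edge with [u] and [v] of one same other colour counts 1, as it blocks a
    colour at [w] and is short-lived too.  Summing the changes of this weight
    over all moves gives at most - 8 (q - 3/2 Delta) ([sum_increment]), which is
    negative under the hypothesis on [q].

    The argument is run in dual form, which avoids extending the weight to a
    path metric: if [F] varies by at most [L] times the weight across every
    single-vertex change, then its average over one step does so with
    L (1 - kappa / n) in place of [L], where kappa depends on [Delta] alone
    ([local_average_contracts]).  Applied to the sign of the difference between
    the law at time [t] and the uniform law, this bounds the total variation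
    distance by n (1 + Delta / 2) (1 - kappa / n)^t ([glauber_tv_dist]), which
    is below [eps] once [t] is a large multiple of n ln n. *)

(** * Edges seen from a vertex, and blocked colours *)

Definition triple (V : finType) (E : {set {set V}}) (u v w : V) : bool :=
  [set u; v; w] \in E.

(** The test is local: edges that avoid [v] may be monochromatic, so the move is
    meaningful on improper colourings as well. *)
Definition blocked (V : finType) (E : {set {set V}}) (q : nat)
    (x : {ffun V -> 'I_q}) (v : V) (k : 'I_q) : bool :=
  [exists e in E, (v \in e) && monochromatic (recolour x v k) e].

Definition local_move (V : finType) (E : {set {set V}}) (q : nat)
    (x : {ffun V -> 'I_q}) (v : V) (k : 'I_q) : {ffun V -> 'I_q} :=
  if blocked E x v k then x else recolour x v k.

Section Hypergraph.
Variables (V : finType) (E : {set {set V}}) (q : nat).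
Hypothesis E3 : uniform_hypergraph 3 E.
Implicit Types (u v w : V) (e : {set V}) (k b : 'I_q) (x y : {ffun V -> 'I_q}).

Lemma triple_neq u v w : triple E u v w -> [/\ u != v, u != w & v != w].
Proof.
move=> /E3; rewrite setUC cardsU1 cards2 !inE !(eq_sym w).
by case: (u =P v); case: (u =P w); case: (v =P w).
Qed.

Lemma tripleC u v w : triple E u v w = triple E u w v.
Proof. by rewrite /triple -!setUA (setUC [set v]). Qed.

Lemma tripleCl u v w : triple E u v w = triple E v u w.
Proof. by rewrite /triple (setUC [set u]). Qed.

Lemma edge_triple e u : e \in E -> u \in e ->
  exists v w, e = [set u; v; w] /\ triple E u v w.
Proof.
move=> eE ue; have := E3 eE; rewrite (cardsD1 u) ue => -[/eqP /cards2P].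
move=> [v [w] [vw euv]]; have -> : e = [set u; v; w].
  by rewrite -setUA -euv setD1K.
exists v, w; split=> //; rewrite /triple -setUA -euv setD1K //.
Qed.

Lemma blockedP x u k :
  reflect (exists v w, [/\ triple E u v w, x v = k & x w = k]) (blocked E x u k).
Proof.
apply: (iffP exists_inP) => [[e eE /andP[ue]]|[v [w [t xv xw]]]].
  have [v [w [-> t]]] := edge_triple eE ue.
  have [uv uw _] := triple_neq t.
  move=> /existsP[c /forall_inP m]; exists v, w.
  have := m u; have := m v; have := m w.
  rewrite !ffunE !inE !eqxx ?orbT /= !(eq_sym _ u) (negbTE uv) (negbTE uw).
  by move=> /(_ isT)/eqP -> /(_ isT)/eqP -> /(_ isT)/eqP ->.
exists [set u; v; w] => //; rewrite !inE eqxx /=.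
apply/existsP; exists k; apply/forall_inP => z; rewrite !inE ffunE.
by case: eqP => //= _ /orP[] /eqP ->; rewrite ?xv ?xw.
Qed.

Lemma recolour_id x u : recolour x u (x u) = x.
Proof. by apply/ffunP => v; rewrite ffunE; case: eqP => // ->. Qed.

Lemma recolourC x u v k b : u != v ->
  recolour (recolour x u k) v b = recolour (recolour x v b) u k.
Proof.
move=> uv; apply/ffunP => z; rewrite !ffunE.
by case: eqVneq => // ->; rewrite eq_sym (negbTE uv).
Qed.

Lemma recolourK x u k b : recolour (recolour x u k) u b = recolour x u b.
Proof. by apply/ffunP => z; rewrite !ffunE; case: eqP. Qed.

Lemma blocked_recolour_same x w b k :
  blocked E (recolour x w b) w k = blocked E x w k.
Proof.
by apply: eq_existsb => e; rewrite recolourK.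
Qed.

(** A witnessing edge for [k] at [u] that stops witnessing when [w] is recoloured
    contains [w]; its third vertex is the [v] below. *)
Lemma blocked_recolour_imp x u w k b :
  blocked E x u k -> ~~ blocked E (recolour x w b) u k ->
  x w = k /\ exists2 v, triple E w u v & x v = k.
Proof.
move=> /blockedP[v [v' [t xv xv']]] /blockedP nb.
have [_ _ vv'] := triple_neq t.
have [vw|vw] := eqVneq v w.
  by split; [rewrite -vw|exists v' => //; rewrite tripleCl -vw].
have [v'w|v'w] := eqVneq v' w.
  by split; [rewrite -v'w|exists v => //; rewrite tripleCl -v'w tripleC].
by case: nb; exists v, v'; rewrite !ffunE (negbTE vw) (negbTE v'w).
Qed.

Lemma blocked_recolour x u w b k : k != x w -> k != b ->
  blocked E (recolour x w b) u k = blocked E x u k.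
Proof.
move=> ka kb; apply/idP/idP => h; apply: contraT => nb.
  have := @blocked_recolour_imp (recolour x w b) u w k (x w) h.
  rewrite recolourK recolour_id ffunE eqxx => /(_ nb)[bk].
  by rewrite bk eqxx in kb.
have [ak _] := blocked_recolour_imp h nb.
by rewrite ak eqxx in ka.
Qed.

Lemma blocked_recolour_neq x u w b k : u != w ->
  blocked E (recolour x w b) u k != blocked E x u k ->
  exists2 v, triple E w u v & x v = k.
Proof.
move=> uw; case: (boolP (blocked E x u k)) => h.
  case: (boolP (blocked _ _ _ _)) => // nb _.
  by have [] := blocked_recolour_imp h nb.
case: (boolP (blocked _ _ _ _)) => // h' _.
have := @blocked_recolour_imp (recolour x w b) u w k (x w) h'.
rewrite recolourK recolour_id => /(_ h)[_ [v t]]; have [_ wv _] := triple_neq t.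
by rewrite ffunE (negbTE (_ : v != w)) 1?eq_sym // => xv; exists v.
Qed.

(** Sums over edges at [w] are written as sums over ordered pairs, so each edge
    is counted twice. *)
Lemma card_triple w : (\sum_u \sum_(v | triple E w u v) 1 <= 2 * degree E w)%N.
Proof.
rewrite pair_big_dep /= (partition_big (fun p : V * V => [set w; p.1; p.2])
  (fun e => e \in [set e in E | w \in e])) /=; last first.
  by move=> [u v] /= t; rewrite !inE eqxx andbT.
rewrite mulnC /degree -sum_nat_const; apply: leq_sum => e; rewrite inE => /andP[eE we].
have [u [v [-> t]]] := edge_triple eE we; have [wu wv uv] := triple_neq t.
rewrite sum1dep_card.
apply: leq_trans (_ : #|[set (u, v); (v, u)]| <= 2)%N; last by rewrite cards2; case: eqP.
apply/subset_leq_card/fintype.subsetP => -[u' v']; rewrite !inE /= !xpair_eqE.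
move=> /andP[t' /eqP s]; have [wu' wv' uv'] := triple_neq t'.
have : u' \in [set w; u; v] by rewrite -s !inE eqxx orbT.
have : v' \in [set w; u; v] by rewrite -s !inE eqxx !orbT.
rewrite !inE !(eq_sym _ w) (negbTE wu') (negbTE wv') /=.
by move=> /orP[] /eqP v'E /orP[] /eqP u'E; move: uv'; rewrite u'E v'E !eqxx ?orbT.
Qed.

(** A colour absent from [w] is blocked at [u] only through edges avoiding [w],
    and each edge blocks at most one colour; the edge {w, u, v} is thus saved. *)
Lemma card_blocked_away x u w v : triple E w u v ->
  (#|[set k | blocked E x u k && (k != x w)]| <= (degree E u).-1)%N.
Proof.
move=> t; set A := [set k | _].
pose Eu := [set e in E | u \in e] :\ [set w; u; v].
have -> : (degree E u).-1 = #|Eu|.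
  by rewrite /degree (cardsD1 [set w; u; v]) !inE eqxx orbT andbT -/(triple E w u v) t.
case: (set_0Vmem A) => [->|[k0 _]]; first by rewrite cards0.
(* The colour blocked at u by e, read off any other vertex of e. *)
pose g e := if [pick v in e :\ u] is Some v then x v else k0.
apply: leq_trans (_ : #|g @: Eu| <= _)%N; last exact: leq_imset_card.
apply/subset_leq_card/fintype.subsetP => k; rewrite !inE.
move=> /andP[/blockedP[y [z [t' xy xz]]] kw].
have [uy uz yz] := triple_neq t'.
apply/imsetP; exists [set u; y; z].
  rewrite !inE eqxx andbT -/(triple E u y z) t' andbT; apply/eqP => s.
  have : w \in [set u; y; z] by rewrite s !inE eqxx.
  have [wu _ _] := triple_neq t; rewrite !inE (negbTE wu) /=.
  by move=> /orP[] /eqP wE; move: kw; rewrite wE ?xy ?xz eqxx.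
rewrite /g; case: pickP => [c|/(_ y)]; rewrite !inE.
  by move=> /andP[/negbTE -> /= /orP[] /eqP ->].
by rewrite eq_sym uy eqxx !orbT.
Qed.

(** A colour blocked at [w] is carried by both other vertices of an edge, hence
    by two ordered pairs. *)
Lemma card_blocked_twice x w :
  (2 * #|[set k | blocked E x w k]| <=
   \sum_u \sum_(v | triple E w u v) (x u == x v))%N.
Proof.
rewrite -sum1_card big_distrr /= pair_big_dep /= .
rewrite [leqRHS](_ : _ = \sum_(p : V * V | triple E w p.1 p.2)
    \sum_(k : 'I_q) ((x p.1 == k) && (x p.2 == k)))%N.
  rewrite exchange_big [leqRHS](bigID [in [set k | blocked E x w k]]) /=.
  apply: leq_trans (leq_addr _ _); apply: leq_sum => k; rewrite inE.
  move=> /blockedP[u [v [t xu xv]]]; have [wu wv uv] := triple_neq t.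
  rewrite (bigD1 (u, v)) //= (bigD1 (v, u)) /=; last first.
    by rewrite tripleC t xpair_eqE negb_and eq_sym uv.
  by rewrite xu xv eqxx.
apply: eq_bigr => -[u v] _ /=; rewrite (bigD1 (x u)) //= eqxx eq_sym big1 ?addn0 //.
by move=> k /negbTE; rewrite eq_sym => ->.
Qed.

End Hypergraph.

(** * The weight of a single disagreement *)

(** [a] and [b] are the two colours at the disagreement vertex, [c] and [d] those
    of the other two vertices of an edge through it. *)
Definition pair_weight (R : realFieldType) (q : nat) (a b c d : 'I_q) : R :=
  (c \in pred2 a b)%:R + (d \in pred2 a b)%:R +
  ((c == d) && (c \notin pred2 a b))%:R.

(** The weight of the pair formed by [x] and [recolour x w b].  The sum counts
    each edge twice.  The constant 8 is the only one for which the accounting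
    of [pair_cost_sym] works at q = 3/2 Delta + 1 for every Delta: with a constant
    c in its place, an ordered pair of distinct colours outside {a, b} costs 6 and
    one coloured [a] and [b] costs c - 2, while the constant pays 3/4 c for each
    of up to 2 Delta ordered pairs. *)
Definition weight (R : realFieldType) (V : finType) (E : {set {set V}})
    (q : nat) (x : {ffun V -> 'I_q}) (w : V) (b : 'I_q) : R :=
  8 + \sum_u \sum_(v | triple E w u v) pair_weight R (x w) b (x u) (x v).

(** The share of the pair ([u], [v]) in the growth of the weight when [u] is
    recoloured with [k].  A vertex [v] of colour [k] may make the move bad, and
    then pays for the largest possible weight of the new disagreement at [u].
    The factor 2 accounts for ([v], [u]), whose weight changes equally. *)
Definition move_cost (R : realFieldType) (V : finType) (E : {set {set V}})
    (q : nat) (x : {ffun V -> 'I_q}) (w : V) (b : 'I_q)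
    (u v : V) (k : 'I_q) : R :=
  if k == x u then 0
  else if k \in pred2 (x w) b then
    if x v == k then 8 + 4 * (max_degree E)%:R
    else 2 * ((x u \notin pred2 (x w) b) && (x u != x v))%:R
  else if blocked E x u k then 0
  else 2 * (pair_weight R (x w) b k (x v) - pair_weight R (x w) b (x u) (x v)).

(** Bounds the change of the weight when [u] is recoloured with [k] in both
    colourings; see [coupled_step]. *)
Definition increment (R : realFieldType) (V : finType) (E : {set {set V}})
    (q : nat) (x : {ffun V -> 'I_q}) (w : V) (b : 'I_q)
    (u : V) (k : 'I_q) : R :=
  if u == w then (if blocked E x w k then 0 else - weight R E x w b)
  else \sum_(v | triple E w u v) move_cost R E x w b u v k.

Section Weight.
Variables (R : realFieldType) (V : finType) (E : {set {set V}}) (q : nat).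
Hypothesis E3 : uniform_hypergraph 3 E.
Local Notation Delta := ((max_degree E)%:R : R).
Implicit Types (u v w : V) (e : {set V}) (k a b c d : 'I_q).
Implicit Types (x y : {ffun V -> 'I_q}).

Lemma pair_weightC a b c d : pair_weight R a b c d = pair_weight R a b d c.
Proof.
rewrite /pair_weight (addrC (c \in _)%:R) (eq_sym c).
by have [->|] := eqVneq d c.
Qed.

Lemma pair_weight_ge0 a b c d : 0 <= pair_weight R a b c d.
Proof. by rewrite /pair_weight -!natrD ler0n. Qed.

Lemma pair_weight_le2 a b c d : pair_weight R a b c d <= 2.
Proof.
rewrite /pair_weight -!natrD ler_nat.
have [->|] := eqVneq c d; first by case: (d \in _).
by case: (c \in _); case: (d \in _).
Qed.

Lemma weight_ge8 x w b : 8 <= weight R E x w b.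
Proof.
rewrite /weight lerDl; apply: sumr_ge0 => u _; apply: sumr_ge0 => v _.
exact: pair_weight_ge0.
Qed.

Lemma degree_le_max u : (degree E u <= max_degree E)%N.
Proof. exact: (@leq_bigmax _ (degree E) u). Qed.

Lemma sum_triple_le w : \sum_u \sum_(v | triple E w u v) (1 : R) <= 2 * Delta.
Proof.
apply: le_trans (_ : (2 * degree E w)%:R <= _); last first.
  by rewrite natrM ler_pM2l ?ler_nat ?degree_le_max.
apply: le_trans (_ : (\sum_u \sum_(v | triple E w u v) 1)%:R <= _); last first.
  by rewrite ler_nat card_triple.
by rewrite natr_sum; apply: ler_sum => u _; rewrite natr_sum.
Qed.

Lemma weight_le x w b : weight R E x w b <= 8 + 4 * Delta.
Proof.
rewrite /weight lerD2l.
have -> : 4 * Delta = 2 * (2 * Delta) by ring.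
apply: le_trans (_ : 2 * \sum_u \sum_(v | triple E w u v) 1 <= _); last first.
  by rewrite ler_pM2l ?sum_triple_le.
rewrite mulr_sumr; apply: ler_sum => u _; rewrite mulr_sumr; apply: ler_sum => v _.
by rewrite mulr1 pair_weight_le2.
Qed.

Lemma sum_delta (T : finType) (F : T -> R) i0 :
  \sum_i (i == i0)%:R * F i = F i0.
Proof.
rewrite (bigD1 i0) //= eqxx mul1r big1 ?addr0 // => i /negbTE ->.
by rewrite mul0r.
Qed.

Lemma weight_recolour x w b u k : u != w ->
  weight R E (recolour x u k) w b = weight R E x w b +
  2 * \sum_(v | triple E w u v)
        (pair_weight R (x w) b k (x v) - pair_weight R (x w) b (x u) (x v)).
Proof.
move=> uw; rewrite /weight -[RHS]addrA; congr (_ + _).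
have -> : recolour x u k w = x w by rewrite ffunE eq_sym (negbTE uw).
have fC := pair_weightC (x w) b.
set f := pair_weight R (x w) b in fC *; clearbody f.
pose g v := f k (x v) - f (x u) (x v).
have tE p r : triple E w p r ->
    f (recolour x u k p) (recolour x u k r) =
    f (x p) (x r) + (p == u)%:R * g r + (r == u)%:R * g p.
  move=> t; have [_ _ pr] := triple_neq E3 t; rewrite /g !ffunE.
  have [pu|pu] := eqVneq p u; have [ru|ru] := eqVneq r u.
  - by rewrite pu ru eqxx in pr.
  - by rewrite pu mul1r mul0r; ring.
  - by rewrite ru mul1r mul0r fC [f k _]fC [f (x u) _]fC; ring.
  - by rewrite !mul0r; ring.
rewrite (eq_bigr (fun p => \sum_(r | triple E w p r) f (x p) (x r) +
    (p == u)%:R * (\sum_(r | triple E w u r) g r) + (triple E w u p)%:R * g p)).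
  rewrite -[X in _ = _ + 2 * X]/(\sum_(v | triple E w u v) g v).
  clearbody g; rewrite !big_split /= -addrA; congr (_ + _).
  rewrite sum_delta mulr_natl mulr2n; congr (_ + _).
  rewrite [RHS]big_mkcond; apply: eq_bigr => p _.
  by case: ifP; rewrite ?mul1r ?mul0r.
move=> p _; rewrite (eq_bigr _ (tE p)); clearbody g; rewrite !big_split /=; congr (_ + _ + _).
  rewrite -mulr_sumr; have [->//|_] := eqVneq p u; by rewrite !mul0r.
rewrite -mulr_suml; congr (_ * _).
rewrite [triple E w u p]tripleC -(sum_delta (fun r => (triple E w p r)%:R)) big_mkcond.
by apply: eq_bigr => r _; case: (triple E w p r); rewrite ?mulr1 ?mulr0.
Qed.

(** Bounds the sum of [move_cost] over all colours: [T] treats the colours [a]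
    and [b], the next term the colour [d] of the other vertex, and the last one
    the unblocked colours outside {a, b}, each of which lowers the weight if [c]
    is in {a, b} or [c = d]. *)
Definition pair_cost a b c d : R :=
  let T k := if k == c then 0 else if d == k then 8 + 4 * Delta
             else 2 * ((c \notin pred2 a b) && (c != d))%:R in
  T a + T b + 2 * ((d \notin pred2 a b) && (c != d))%:R
  - 2 * ((c \in pred2 a b)%:R + ((c == d) && (c \notin pred2 a b))%:R) *
    (q%:R - Delta - 1 - (c \notin pred2 a b)%:R).

Lemma card_free x w b u v : triple E w u v ->
  q%:R - Delta - 1 - (x u \notin pred2 (x w) b)%:R <=
  \sum_(k : 'I_q) ([&& k \notin pred2 (x w) b, k != x u & ~~ blocked E x u k]%:R : R).
Proof.
move=> t; rewrite -natr_sum -big_mkcond sum1dep_card.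
set U := [set k | _]; pose A := [set k | blocked E x u k && (k != x w)].
have cA : (#|A| < max_degree E)%N.
  apply: leq_trans (degree_le_max u).
  apply: leq_ltn_trans (card_blocked_away E3 x t) _.
  rewrite prednK // /degree; apply/card_gt0P; exists [set w; u; v].
  by rewrite !inE eqxx orbT andbT.
pose S := [set x w; b; x u].
have cS : (#|S| <= 2 + (x u \notin pred2 (x w) b))%N.
  rewrite /S setUC cardsU1 cards2 !inE addnC leq_add ?ltnS ?leq_b1 //.
have : (q <= #|U| + #|S| + #|A|)%N.
  rewrite -[X in (X <= _)%N]card_ord -cardsT.
  apply: leq_trans (_ : #|U :|: S :|: A| <= _)%N; last first.
    apply: leq_trans (leq_card_setU _ _) _.
    by rewrite leq_add2r leq_card_setU.
  apply/subset_leq_card/fintype.subsetP => k _; rewrite !inE.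
  by case: (k == x w); case: (k == b); case: (k == x u); case: (blocked E x u k).
move=> hq; have : (q + 1 <= #|U| + 2 + (x u \notin pred2 (x w) b) + max_degree E)%N by lia.
by rewrite -(ler_nat R) !natrD; lra.
Qed.

Lemma sum_move_cost x w b u v : x w != b -> triple E w u v ->
  \sum_k move_cost R E x w b u v k <= pair_cost (x w) b (x u) (x v).
Proof.
move=> ab t; rewrite /pair_cost.
set a := x w in ab *; set c := x u; set d := x v.
pose T k : R := if k == c then 0 else if d == k then 8 + 4 * Delta
             else 2 * ((c \notin pred2 a b) && (c != d))%:R.
pose L : R := 2 * ((c \in pred2 a b)%:R + ((c == d) && (c \notin pred2 a b))%:R).
pose free k := [&& k \notin pred2 a b, k != c & ~~ blocked E x u k].
have D0 : 0 <= Delta by apply: ler0n.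
have T0 k : 0 <= T k.
  by rewrite /T; case: ifP => // _; case: ifP => _; [lra|rewrite mulr_ge0].
have L0 : 0 <= L by rewrite mulr_ge0 // addr_ge0.
have chE k : move_cost R E x w b u v k <=
    (k == a)%:R * T a + (k == b)%:R * T b
    + (k == d)%:R * (2 * ((d \notin pred2 a b) && (c != d))%:R)
    - (free k)%:R * L.
  have N0 : 0 <= 2 * ((d \notin pred2 a b) && (c != d))%:R :> R by rewrite mulr_ge0.
  rewrite /move_cost -/a -/c -/d.
  case: ifP => kc.
    rewrite /free kc /= andbF mul0r subr0.
    by rewrite !addr_ge0 // mulr_ge0.
  case: ifP => kS.
    rewrite /free kS /= mul0r subr0.
    apply: le_trans (_ : (k == a)%:R * T a + (k == b)%:R * T b <= _); last first.
      by rewrite lerDl mulr_ge0.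
    have -> : (if d == k then 8 + 4 * Delta
               else 2 * ((c \notin pred2 a b) && (c != d))%:R) = T k.
      by rewrite /T kc.
    by case/orP: kS => /eqP ->;
      rewrite eqxx mul1r ?lerDl ?lerDr mulr_ge0.
  rewrite /free kS kc /=; move: kS => /norP[/negbTE ka /negbTE kb].
  rewrite ka kb !mul0r !add0r; case: ifP => _; first by rewrite mul0r subr0 mulr_ge0.
  rewrite mul1r /pair_weight /L !inE ka kb /= andbT.
  have [kd|kd] := eqVneq k d.
    rewrite -kd ka kb /= (eq_sym c k) kc /=; lra.
  rewrite ?(negbTE kd) /= mul0r; lra.
apply: le_trans (ler_sum _ (fun k _ => chE k)) _.
rewrite big_split /= sumrN -!mulr_suml !big_split /= -!mulr_suml.
have sum1 (k0 : 'I_q) : \sum_(k : 'I_q) ((k == k0)%:R : R) = 1.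
  by rewrite (bigD1 k0) //= eqxx big1 ?addr0 // => k /negbTE ->.
rewrite !sum1 !mul1r lerD2l lerN2 mulrC.
by rewrite ler_wpM2r // (card_free x b t).
Qed.

(** The budget of one ordered pair.  Besides its cost under moves away from [w],
    a pair with equal colours blocks half a colour at [w], which weighs at most
    8 + 4 Delta, and every pair gains its weight whenever [w] is recoloured.  Only
    the sum over ([c], [d]) and ([d], [c]) is at most 12: a pair with [d] but not
    [c] in {a, b} is expensive, and its mirror image compensates. *)
Lemma pair_cost_sym a b c d : a != b -> 3 / 2 * Delta + 1 <= q%:R ->
  pair_cost a b c d + pair_cost a b d c
  + 2 * ((4 + 2 * Delta) * (c == d)%:R - q%:R * pair_weight R a b c d) <= 12.
Proof.
move=> ab hq; have D0 : 0 <= Delta by apply: ler0n.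
rewrite /pair_cost /pair_weight !inE (eq_sym d c) (eq_sym a c) (eq_sym a d)
  (eq_sym b c) (eq_sym b d).
have ca : (c == a) ==> (c != b) && ((c == d) == (d == a)).
  by apply/implyP => /eqP ->; rewrite ab (eq_sym a) eqxx.
have cb : (c == b) ==> ((c == d) == (d == b)).
  by apply/implyP => /eqP ->; rewrite (eq_sym b) eqxx.
have da : (d == a) ==> (d != b) && ((c == d) == (c == a)).
  by apply/implyP => /eqP ->; rewrite ab eqxx.
have db : (d == b) ==> ((c == d) == (c == b)).
  by apply/implyP => /eqP ->; rewrite eqxx.
move: ca cb da db; case: (c == a); case: (c == b); case: (d == a);
  case: (d == b); case: (c == d) => //= _ _ _ _; lra.
Qed.

End Weight.

(** * One step contracts Lipschitz constants *)

Definition weight_lipschitz (R : realFieldType) (V : finType)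
    (E : {set {set V}}) (q : nat) (F : {ffun V -> 'I_q} -> R) (L : R) : Prop :=
  forall x w b, `|F x - F (recolour x w b)| <= L * weight R E x w b.

Definition local_average (R : realFieldType) (V : finType)
    (E : {set {set V}}) (q : nat) (F : {ffun V -> 'I_q} -> R)
    (x : {ffun V -> 'I_q}) : R :=
  \sum_v \sum_k #|V|%:R^-1 * q%:R^-1 * F (local_move E x v k).

Definition contraction_rate (R : realFieldType) (D : nat) : R :=
  4 / ((3 * D%:R + 2) * (D%:R + 2)).

Section Contraction.
Variables (R : realFieldType) (V : finType) (E : {set {set V}}) (q : nat).
Hypothesis E3 : uniform_hypergraph 3 E.
Local Notation Delta := ((max_degree E)%:R : R).
Hypothesis hq : 3 / 2 * Delta + 1 <= q%:R.
Implicit Types (u v w : V) (e : {set V}) (k a b c d : 'I_q).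
Implicit Types (x y : {ffun V -> 'I_q}) (F : {ffun V -> 'I_q} -> R).

Lemma exchange_triple w (F : V -> V -> R) :
  \sum_u \sum_(v | triple E w u v) F u v = \sum_u \sum_(v | triple E w u v) F v u.
Proof.
rewrite (exchange_big_dep predT) //=; apply: eq_bigr => u _.
by apply: eq_bigl => v; rewrite tripleC.
Qed.

Lemma sum_increment_root x w b : 
  \sum_k increment R E x w b w k <=
  - (q%:R * weight R E x w b) +
  \sum_u \sum_(v | triple E w u v) (4 + 2 * Delta) * (x u == x v)%:R.
Proof.
have D0 : 0 <= Delta by apply: ler0n.
set B := #|[set k | blocked E x w k]|.
have -> : \sum_k increment R E x w b w k =
    B%:R * weight R E x w b - q%:R * weight R E x w b.
  transitivity (\sum_k ((blocked E x w k)%:R * weight R E x w b - weight R E x w b)).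
    apply: eq_bigr => k _; rewrite /increment eqxx.
    by case: ifP => _; rewrite ?mul1r ?mul0r ?subrr ?sub0r.
  rewrite sumrB -mulr_suml sumr_const card_ord -[in LHS]mulr_natl; congr (_ * _ - _).
  by rewrite -natr_sum -big_mkcond sum1dep_card.
rewrite addrC lerD2l.
have hB : 2 * B%:R <= \sum_u \sum_(v | triple E w u v) (x u == x v)%:R :> R.
  have := card_blocked_twice E3 x w; rewrite -(ler_nat R) natrM natr_sum.
  by under eq_bigr do rewrite natr_sum.
apply: le_trans (ler_wpM2l (ler0n _ _) (weight_le R E3 x w b)) _.
apply: le_trans (_ : (4 + 2 * Delta) * (2 * B%:R) <= _); first by lra.
apply: le_trans (ler_wpM2l _ hB) _; first by lra.
by rewrite mulr_sumr; under eq_bigr do rewrite mulr_sumr.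
Qed.

Lemma sum_increment_away x w b : x w != b ->
  \sum_(u | u != w) \sum_k increment R E x w b u k <=
  \sum_u \sum_(v | triple E w u v) pair_cost R E (x w) b (x u) (x v).
Proof.
move=> ab; rewrite [leRHS](bigD1 w) //= [X in _ <= X + _]big1 ?add0r; last first.
  by move=> v t; have [] := triple_neq E3 t; rewrite eqxx.
apply: ler_sum => u uw; rewrite /increment (negbTE uw) exchange_big /=.
by apply: ler_sum => v t; apply: sum_move_cost.
Qed.

(** At most 2 Delta ordered pairs with a budget of 6 each give 12 Delta, against
    the 8 q gained from the constant 8 by the moves at [w]. *)
Lemma sum_increment x w b : x w != b ->
  \sum_u \sum_k increment R E x w b u k <= - (8 * (q%:R - 3 / 2 * Delta)).
Proof.
move=> ab; rewrite (bigD1 w) //=.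
apply: le_trans (lerD (sum_increment_root x w b) (sum_increment_away ab)) _.
pose G u v : R := (4 + 2 * Delta) * (x u == x v)%:R
  - q%:R * pair_weight R (x w) b (x u) (x v) + pair_cost R E (x w) b (x u) (x v).
have -> : - (q%:R * weight R E x w b) +
    \sum_u \sum_(v | triple E w u v) (4 + 2 * Delta) * (x u == x v)%:R +
    \sum_u \sum_(v | triple E w u v) pair_cost R E (x w) b (x u) (x v) =
    - (8 * q%:R) + \sum_u \sum_(v | triple E w u v) G u v.
  rewrite (_ : \sum_u \sum_(v | triple E w u v) G u v =
    \sum_u \sum_(v | triple E w u v) (4 + 2 * Delta) * (x u == x v)%:R
    - q%:R * \sum_u \sum_(v | triple E w u v) pair_weight R (x w) b (x u) (x v)
    + \sum_u \sum_(v | triple E w u v) pair_cost R E (x w) b (x u) (x v)).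
    by rewrite /weight; ring.
  rewrite mulr_sumr -sumrB -big_split; apply: eq_bigr => u _ /=.
  by rewrite mulr_sumr -sumrB -big_split.
suff : 2 * \sum_u \sum_(v | triple E w u v) G u v <= 24 * Delta by lra.
rewrite mulr_natl mulr2n {2}exchange_triple -big_split /=.
apply: le_trans (_ : 12 * \sum_u \sum_(v | triple E w u v) 1 <= _); last first.
  by have := sum_triple_le R E3 w; lra.
rewrite mulr_sumr; apply: ler_sum => u _; rewrite -big_split mulr_sumr /=.
apply: ler_sum => v _; rewrite mulr1.
apply: le_trans (pair_cost_sym (x u) (x v) ab hq).
rewrite /G (eq_sym (x v)) [pair_weight _ _ _ (x v) _]pair_weightC le_eqVlt.
by apply/orP; left; apply/eqP; ring.
Qed.

Lemma move_cost_ge0 x w b u v k : k \in pred2 (x w) b -> 0 <= move_cost R E x w b u v k.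
Proof.
move=> kS; rewrite /move_cost kS; case: ifP => // _; case: ifP => _.
  by have : 0 <= Delta by []; lra.
by rewrite mulr_ge0.
Qed.

Lemma move_cost_ge_diff x w b u v k : k != x u -> k \in pred2 (x w) b -> 
  2 * (pair_weight R (x w) b k (x v) - pair_weight R (x w) b (x u) (x v)) <=
  move_cost R E x w b u v k.
Proof.
move=> ku kS; rewrite /move_cost kS (negbTE ku).
have D0 : 0 <= Delta by [].
case: ifP => xv.
  have := pair_weight_le2 R (x w) b k (x v).
  have := pair_weight_ge0 R (x w) b (x u) (x v); lra.
rewrite /pair_weight kS eq_sym xv /=.
by case: (x u \in _); case: (x u == x v) => /=; lra.
Qed.

(** If both colourings move or both stay, they remain a single disagreement at
    [w].  If only one moves, that one gains a disagreement at [u] with its former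
    self, whose weight is at most 8 + 4 Delta; one of the pairs at [u] pays. *)
Lemma coupled_step F L x w b u k : 0 <= L -> weight_lipschitz E F L -> x w != b ->
  `|F (local_move E x u k) - F (local_move E (recolour x w b) u k)| <=
  L * (weight R E x w b + increment R E x w b u k).
Proof.
move=> L0 lipF ab; rewrite /increment /local_move.
case: eqVneq => [->|uw].
  rewrite blocked_recolour_same recolourK.
  case: ifP => _; first by rewrite addr0.
  by rewrite !subrr normr0 mulr0.
set y := recolour x w b.
have yu : y u = x u by rewrite ffunE (negbTE uw).
have [kE|ku] := eqVneq k (x u).
  rewrite big1; last by move=> v _; rewrite /move_cost kE eqxx.
  have -> : recolour x u k = x by rewrite kE recolour_id.
  have -> : recolour y u k = y by rewrite kE -yu recolour_id.
  by rewrite !if_same addr0; exact: lipF.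
have moved : `|F (recolour x u k) - F (recolour y u k)| <=
    L * (weight R E x w b + 2 * \sum_(v | triple E w u v)
    (pair_weight R (x w) b k (x v) - pair_weight R (x w) b (x u) (x v))).
  by rewrite /y -recolourC // -(weight_recolour R E3).
have [kS|kS] := boolP (k \in pred2 (x w) b); last first.
  have bE : blocked E y u k = blocked E x u k.
    by rewrite blocked_recolour //; apply: contra kS => /eqP ->; rewrite !inE eqxx ?orbT.
  rewrite bE; case: ifP => bx.
    rewrite big1 ?addr0; last by move=> v _; rewrite /move_cost (negbTE ku) (negbTE kS) bx.
    exact: lipF.
  rewrite (eq_bigr (fun v => 2 * (pair_weight R (x w) b k (x v)
    - pair_weight R (x w) b (x u) (x v)))).
    by rewrite -mulr_sumr.
  by move=> v _; rewrite /move_cost (negbTE ku) (negbTE kS) bx.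
have ch0 : 0 <= \sum_(v | triple E w u v) move_cost R E x w b u v k.
  by apply: sumr_ge0 => v _; apply: move_cost_ge0.
have [bE|bNE] := eqVneq (blocked E y u k) (blocked E x u k).
  rewrite bE; case: ifP => bx.
    apply: le_trans (lipF _ _ _) _.
    by rewrite ler_wpM2l // lerDl.
  apply: le_trans moved _; rewrite ler_wpM2l // lerD2l mulr_sumr.
  by apply: ler_sum => v _; apply: move_cost_ge_diff.
have [v0 t xv0] := blocked_recolour_neq E3 uw bNE.
have chM : 8 + 4 * Delta <= \sum_(v | triple E w u v) move_cost R E x w b u v k.
  rewrite (bigD1 v0) //= {1}/move_cost (negbTE ku) kS xv0 eqxx lerDl.
  by apply: sumr_ge0 => v _; apply: move_cost_ge0.
apply: le_trans (_ : L * (weight R E x w b + (8 + 4 * Delta)) <= _); last first.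
  by rewrite ler_wpM2l // lerD2l.
rewrite mulrDr.
have far z : `|F z - F (recolour z u k)| <= L * (8 + 4 * Delta).
  by apply: le_trans (lipF _ _ _) _; rewrite ler_wpM2l // (weight_le R E3).
move: bNE; case: (blocked E y u k); case: (blocked E x u k) => //= _.
  rewrite (_ : F _ - F y = (F x - F y) - (F x - F (recolour x u k))); last by ring.
  by apply: le_trans (ler_normB _ _) _; rewrite lerD ?lipF ?far.
rewrite (_ : F x - _ = (F x - F y) + (F y - F (recolour y u k))); last by ring.
by apply: le_trans (ler_normD _ _) _; rewrite lerD ?lipF ?far.
Qed.

Lemma contraction_rate_gt0 D : 0 < contraction_rate R D.
Proof. by rewrite /contraction_rate divr_gt0 ?mulr_gt0 ?ltr_wpDl ?mulr_ge0. Qed.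

Lemma contraction_rate_le1 D : contraction_rate R D <= 1.
Proof.
have D0 : 0 <= D%:R :> R by [].
rewrite /contraction_rate ler_pdivrMr ?mulr_gt0 ?ltr_wpDl ?mulr_ge0 //.
by nra.
Qed.

Lemma local_average_contracts F L : 0 <= L -> weight_lipschitz E F L ->
  weight_lipschitz E (local_average E F)
    (L * (1 - contraction_rate R (max_degree E) / #|V|%:R)).
Proof.
move=> L0 lipF x w b.
have n0 : 0 < #|V|%:R :> R by rewrite ltr0n; apply/card_gt0P; exists w.
have q0 : 0 < q%:R :> R by rewrite ltr0n (leq_ltn_trans (leq0n b)).
have rate1 := contraction_rate_le1 (max_degree E).
have W8 := weight_ge8 R E x w b.
have D0 : 0 <= Delta by [].
have n1 : 1 <= #|V|%:R :> R by rewrite ler1n -(ltr0n R).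
have [ab|ab] := eqVneq (x w) b.
  have W0 : 0 <= weight R E x w b by rewrite (le_trans _ W8).
  rewrite -{1}ab recolour_id subrr normr0 mulr_ge0 // mulr_ge0 // subr_ge0.
  by rewrite ler_pdivrMr // mul1r (le_trans rate1).
rewrite /local_average -sumrB.
have -> : \sum_u (\sum_k #|V|%:R^-1 * q%:R^-1 * F (local_move E x u k) -
    \sum_k #|V|%:R^-1 * q%:R^-1 * F (local_move E (recolour x w b) u k)) =
    #|V|%:R^-1 * q%:R^-1 * \sum_u \sum_k (F (local_move E x u k) -
      F (local_move E (recolour x w b) u k)).
  rewrite mulr_sumr; apply: eq_bigr => u _; rewrite -sumrB mulr_sumr.
  by apply: eq_bigr => k _; rewrite mulrBr.
rewrite normrM ger0_norm ?mulr_ge0 ?invr_ge0 //.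
rewrite -invfM ler_pdivrMl ?mulr_gt0 //.
have : `|\sum_u \sum_k (F (local_move E x u k) -
      F (local_move E (recolour x w b) u k))| <=
    L * \sum_u \sum_k (weight R E x w b + increment R E x w b u k).
  apply: le_trans (ler_norm_sum _ _ _) _; rewrite mulr_sumr; apply: ler_sum => u _.
  apply: le_trans (ler_norm_sum _ _ _) _; rewrite mulr_sumr; apply: ler_sum => k _.
  exact: coupled_step.
move=> /le_trans; apply.
rewrite [leRHS](_ : _ = L * (#|V|%:R * q%:R *
    ((1 - contraction_rate R (max_degree E) / #|V|%:R) * weight R E x w b))); last by ring.
rewrite ler_wpM2l //.
have -> : \sum_u \sum_k (weight R E x w b + increment R E x w b u k) =
    #|V|%:R * (q%:R * weight R E x w b) + \sum_u \sum_k increment R E x w b u k.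
  transitivity (\sum_(u : V) (q%:R * weight R E x w b + \sum_k increment R E x w b u k)).
    by apply: eq_bigr => u _; rewrite big_split /= sumr_const card_ord -[in LHS]mulr_natl.
  by rewrite big_split /= sumr_const [in RHS]mulr_natl.
have hI := sum_increment ab.
apply: le_trans (_ : #|V|%:R * (q%:R * weight R E x w b)
  - contraction_rate R (max_degree E) * (q%:R * weight R E x w b) <= _); last first.
  rewrite le_eqVlt; apply/orP; left; apply/eqP; field; lra.
rewrite lerD2l; apply: le_trans hI _; rewrite lerN2.
have Wle := weight_le R E3 x w b.
apply: le_trans (_ : contraction_rate R (max_degree E) * (q%:R * (8 + 4 * Delta)) <= _).
  by rewrite ler_wpM2l ?(ltW (contraction_rate_gt0 _)) // ler_wpM2l // ltW.
rewrite /contraction_rate mulrAC ler_pdivrMr; last by rewrite mulr_gt0; lra.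
have h : 2 * q%:R <= (q%:R - 3 / 2 * Delta) * (3 * Delta + 2).
  have : 0 <= (q%:R - (3 / 2 * Delta + 1)) * Delta by rewrite mulr_ge0 ?subr_ge0.
  by lra.
have D2 : 0 <= 8 * (Delta + 2) by lra.
by have := ler_wpM2l D2 h; lra.

Qed.

End Contraction.

(** * From contraction to total variation *)

Section Mixing.
Variables (R : realType) (V : finType) (E : {set {set V}}) (q : nat).
Hypothesis E3 : uniform_hypergraph 3 E.
Local Notation Delta := ((max_degree E)%:R : R).
Hypothesis hq : 3 / 2 * Delta + 1 <= q%:R.
Implicit Types (u v w : V) (e : {set V}) (k a b c d : 'I_q).
Implicit Types (F : {ffun V -> 'I_q} -> R).
Local Notation rate := (contraction_rate R (max_degree E) / #|V|%:R).

Lemma rate_le1 : rate <= 1.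
Proof.
case: (posnP #|V|) => [->|n0]; first by rewrite invr0 mulr0.
rewrite ler_pdivrMr ?ltr0n // mul1r (le_trans (contraction_rate_le1 _ _)) //.
by rewrite ler1n.
Qed.

Lemma iter_local_average_lipschitz t F L : 0 <= L -> weight_lipschitz E F L ->
  weight_lipschitz E (iter t (@local_average R V E q) F) (L * (1 - rate) ^+ t).
Proof.
move=> L0 lipF; elim: t => [|t IH]; first by rewrite expr0 mulr1.
rewrite exprSr mulrA; apply: local_average_contracts => //.
by rewrite mulr_ge0 ?exprn_ge0 ?subr_ge0 ?rate_le1.
Qed.

(** The two colourings are joined by changing one vertex at a time; the path
    goes through improper colourings in general. *)
Lemma lipschitz_diameter F L x y : 0 <= L -> weight_lipschitz E F L ->
  `|F x - F y| <= L * (8 + 4 * Delta) * #|V|%:R.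
Proof.
move=> L0 lipF; have D0 : 0 <= Delta by [].
have M0 : 0 <= L * (8 + 4 * Delta) by rewrite mulr_ge0 //; lra.
suff H n (x' : {ffun V -> 'I_q}) : (#|[set v | x' v != y v]| <= n)%N ->
    `|F x' - F y| <= L * (8 + 4 * Delta) * n%:R.
  by apply: H; exact: max_card.
elim: n x' => [|n IH] x' dxy; case: (pickP (fun v => x' v != y v)) => [v xv|xy].
- by move: dxy; rewrite leqn0 cards_eq0 => /eqP/setP/(_ v); rewrite !inE xv.
- rewrite (_ : x' = y) ?subrr ?normr0 ?mulr0 //.
  by apply/ffunP => v; apply/eqP/negbFE/xy.
- pose z := recolour x' v (y v).
  have dzy : (#|[set u | z u != y u]| <= n)%N.
    move: dxy; rewrite (cardsD1 v) inE xv add1n ltnS; apply: leq_trans.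
    apply/subset_leq_card/fintype.subsetP => u; rewrite !inE ffunE.
    by case: (eqVneq u v) => [->|_] /=; rewrite ?eqxx.
  have -> : F x' - F y = (F x' - F z) + (F z - F y) by ring.
  apply: le_trans (ler_normD _ _) _.
  rewrite -[n.+1%:R]natr1 [_ * (n%:R + 1)]mulrDr mulr1 addrC lerD ?IH // (le_trans (lipF _ _ _)) //.
  by rewrite ler_wpM2l // (weight_le R E3).
- have -> : x' = y by apply/ffunP => v; apply/eqP/negbFE/xy.
  by rewrite subrr normr0 mulr_ge0.
Qed.

Lemma proper_recolour (x : {ffun V -> 'I_q}) v k : Defs.proper E x ->
  Defs.proper E (recolour x v k) = ~~ blocked E x v k.
Proof.
move=> /forall_inP px.
apply/forall_inP/negP => [py /exists_inP[e eE /andP[_]]|nb e eE].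
  by rewrite (negbTE (py e eE)).
apply/negP => m; case: (boolP (v \in e)) => ve.
  by case: nb; apply/exists_inP; exists e; rewrite // ve.
case/negP: (px e eE); move: m => /existsP[c /forall_inP mc].
apply/existsP; exists c; apply/forall_inP => u ue; have := mc u ue.
by rewrite ffunE; case: (eqVneq u v) ue ve => // -> ->.
Qed.

Lemma val_glauber_move (x : proper_colouring E q) v k :
  val (glauber_move x v k) = local_move E (val x) v k.
Proof.
by rewrite /glauber_move val_insubd proper_recolour ?(valP x) // /local_move if_neg.
Qed.

Lemma glauber_local_average F (x : proper_colouring E q) :
  \sum_y glauber R x y * F (val y) = local_average E F (val x).
Proof.
rewrite /glauber /local_average.
under eq_bigr do rewrite mulr_suml.
rewrite exchange_big /=; apply: eq_bigr => v _.
under eq_bigr do rewrite mulr_suml.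
rewrite exchange_big /=; apply: eq_bigr => k _.
rewrite (bigD1 (glauber_move x v k)) //= eqxx mulr1 val_glauber_move.
rewrite big1 ?addr0 // => y /negbTE; rewrite eq_sym => ->.
by rewrite mulr0 mul0r.
Qed.

Lemma next_law_dual F (mu : proper_colouring E q -> R) :
  \sum_y next_law (@glauber R V E q) mu y * F (val y) =
  \sum_x mu x * local_average E F (val x).
Proof.
rewrite /next_law; under eq_bigr do rewrite mulr_suml.
rewrite exchange_big /=; apply: eq_bigr => x _.
rewrite -glauber_local_average mulr_sumr.
by apply: eq_bigr => y _; rewrite mulrA.
Qed.

Lemma iter_law_dual t F (mu : proper_colouring E q -> R) :
  \sum_y iter t (next_law (@glauber R V E q)) mu y * F (val y) =
  \sum_x mu x * iter t (@local_average R V E q) F (val x).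
Proof.
by elim: t F => //= t IH F; rewrite next_law_dual IH -iterSr.
Qed.

Lemma law_dual t F (x0 : proper_colouring E q) :
  \sum_y law (@glauber R V E q) x0 t y * F (val y) =
  iter t (@local_average R V E q) F (val x0).
Proof.
rewrite iter_law_dual (bigD1 x0) //= eqxx mul1r big1 ?addr0 // => y /negbTE ->.
by rewrite mul0r.
Qed.

Lemma iter_stationary t : (0 < #|V|)%N -> (0 < q)%N ->
  iter t (next_law (@glauber R V E q)) (@uniform_law R _) = @uniform_law R _.
Proof.
move=> n0 q0; elim: t => //= t ->; apply/funext => y.
exact: glauber_stationary.
Qed.

(** The distance is half the integral of the sign [s] of the difference of the
    two laws.  By duality and stationarity that integral is an average of
    differences of the [t]-step average of [s], which the contraction makes
    small.  Any extension of [s] to improper colourings would do; 0 keeps the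
    bound 1, so the Lipschitz constant starts at 2 / 8. *)
Lemma glauber_tv_dist t (x0 : proper_colouring E q) : (0 < #|V|)%N -> (0 < q)%N ->
  tv_dist (law (@glauber R V E q) x0 t) (@uniform_law R _) <=
  #|V|%:R * (1 + Delta / 2) * (1 - rate) ^+ t.
Proof.
move=> n0 q0; set mu := law _ _ _; pose nu := @uniform_law R (proper_colouring E q); rewrite -/nu.
pose s (y : proper_colouring E q) : R := Num.sg (mu y - nu y).
pose F (x : {ffun V -> 'I_q}) : R := if insub x is Some y then s y else 0.
have FE (y : proper_colouring E q) : F (val y) = s y by rewrite /F valK.
have F1 x : `|F x| <= 1.
  rewrite /F; case: insubP => [y _ _|_]; last by rewrite normr0.
  by rewrite /s normr_sg lern1 leq_b1.
have lipF : weight_lipschitz E F 4^-1.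
  move=> x w b; have := weight_ge8 R E x w b.
  have := F1 x; have := F1 (recolour x w b); have := ler_normB (F x) (F (recolour x w b)).
  lra.
have D0 : 0 <= Delta by [].
set G := iter t (@local_average R V E q) F.
pose K := 4^-1 * (1 - rate) ^+ t * (8 + 4 * Delta) * #|V|%:R.
have GK x y : `|G x - G y| <= K.
  apply: lipschitz_diameter; last by apply: iter_local_average_lipschitz; rewrite ?invr_ge0.
  by rewrite mulr_ge0 ?invr_ge0 // exprn_ge0 ?subr_ge0 ?rate_le1.
have nuE : \sum_x nu x = 1.
  rewrite sumr_const -[_ *+ _]mulr_natr mulVf // pnatr_eq0 -lt0n.
  by apply/card_gt0P; exists x0.
have sumE : \sum_y `|mu y - nu y| = G (val x0) - \sum_x nu x * G (val x).
  rewrite /G -law_dual -iter_law_dual iter_stationary // -sumrB.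
  by apply: eq_bigr => y _; rewrite -mulrBl FE /s normrEsg mulrC.
have hK : G (val x0) - \sum_x nu x * G (val x) <= K.
  rewrite -[G (val x0)]mul1r -[K]mul1r -nuE !mulr_suml -sumrB; apply: ler_sum => x _.
  rewrite -mulrBr ler_wpM2l ?invr_ge0 //.
  exact: le_trans (ler_norm _) (GK _ _).
rewrite /tv_dist sumE (_ : _ * _ * _ = 2^-1 * K); first by rewrite ler_wpM2l.
by rewrite /K; set p := (1 - rate) ^+ t; field.
Qed.

End Mixing.

Lemma exponential_decay_time (R : realType) (n : nat) (A r eps : R) (t : nat) :
  0 < A -> 0 < r <= n%:R -> 0 < eps -> (0 < n)%N ->
  n%:R / r * (ln n%:R + ln (A / eps)) <= t%:R ->
  n%:R * A * (1 - r / n%:R) ^+ t <= eps.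
Proof.
move=> A0 /andP[r0 rn] e0 n0 ht.
have n0' : 0 < n%:R :> R by rewrite ltr0n.
have r1 : 0 <= 1 - r / n%:R by rewrite subr_ge0 ler_pdivrMr // mul1r.
have hexp : (1 - r / n%:R) ^+ t <= expR (- (ln n%:R + ln (A / eps))).
  apply: le_trans (_ : expR (- (r / n%:R)) ^+ t <= _).
    by rewrite lerXn2r ?nnegrE ?expR_ge0 // (le_trans _ (expR_ge1Dx _)).
  rewrite -expRM_natl ler_expR mulrN lerN2.
  move: ht; rewrite -ler_pdivlMl ?divr_gt0 // invf_div => /le_trans; apply.
  by rewrite mulrC.
apply: le_trans (ler_wpM2l _ hexp) _; first by rewrite mulr_ge0 ?ltW.
rewrite expRN expRD !lnK ?posrE ?divr_gt0 //.
rewrite le_eqVlt; apply/orP; left; apply/eqP; field; lra.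
Qed.

Theorem theorem5p1 (R : realType) (Delta : nat) (eps : R)
    (eps_gt0 : 0 < eps) (eps_lt1 : eps < 1) :
  exists (C : R) (N : nat),
    forall (V : finType) (E : {set {set V}}) (q : nat),
      (N <= #|V|)%N ->
      uniform_hypergraph 3 E ->
      max_degree E = Delta ->
      Num.ceil (3 / 2 * Delta%:R + 1 : R) <= q%:Z ->
      exists tau : nat,
        is_mixing_time (@glauber R V E q)
          (@uniform_law R (proper_colouring E q)) eps tau /\
        tau%:R <= C * (#|V|%:R * ln (#|V|%:R : R)).
Proof.
pose r : R := contraction_rate R Delta.
pose A : R := 1 + Delta%:R / 2.
have r0 : 0 < r := contraction_rate_gt0 R Delta.
have r1 : r <= 1 := contraction_rate_le1 R Delta.
have A1 : 1 <= A by rewrite lerDl divr_ge0.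
have lnA : 0 <= ln (A / eps).
  by apply: ln_ge0; rewrite ler_pdivlMr // mul1r (le_trans _ A1) // ltW.
(* From this N on, ln n >= 1, so that additive constants are absorbed by ln n. *)
exists (r^-1 * (1 + ln (A / eps)) + 1), (Num.truncn (expR 1 : R)).+1 => V E q nN E3 dE.
rewrite ceil_le_int => hq.
have {}hq : 3 / 2 * (max_degree E)%:R + 1 <= q%:R :> R by rewrite dE.
have D0 : 0 <= (max_degree E)%:R :> R by [].
have q0 : (0 < q)%N by rewrite -(ltr0n R); lra.
set n := #|V| in nN *.
have n0 : (0 < n)%N by apply: leq_trans nN.
have ln1 : 1 <= ln n%:R :> R.
  rewrite -ler_expR lnK ?posrE ?ltr0n //.
  by apply: le_trans (ltW (truncnS_gt _)) _; rewrite ler_nat.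
have n1 : 1 <= n%:R :> R by rewrite ler1n.
pose T := n%:R / r * (ln n%:R + ln (A / eps)).
have T0 : 0 <= T.
  by rewrite mulr_ge0 ?addr_ge0 ?(le_trans _ ln1) // divr_ge0 // ltW.
(* The truncation costs at most 1, which the last summand of the constant absorbs. *)
pose t0 := (Num.truncn T).+1.
have mixed : mixed_from (@glauber R V E q)
    (@uniform_law R (proper_colouring E q)) eps t0.
  move=> x0 t ht; apply: le_trans (glauber_tv_dist E3 hq t x0 n0 q0) _.
  rewrite dE; apply: exponential_decay_time; [exact: lt_le_trans ltr01 A1| |by []|by []|].
    by rewrite r0 (le_trans r1) // ler1n.
  apply: le_trans (ltW (truncnS_gt T)) _; by rewrite ler_nat.
(* The least mixing time exists because mixing at some time is now known. *)
have ex : exists t, `[< mixed_from (@glauber R V E q)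
    (@uniform_law R (proper_colouring E q)) eps t >].
  by exists t0; apply/asboolP.
have [tau /asboolP mtau mintau] := ex_minnP ex.
exists tau; split; first by split=> // t mt; apply: mintau; apply/asboolP.
apply: le_trans (_ : t0%:R <= _).
  by rewrite ler_nat; apply: mintau; apply/asboolP.
apply: le_trans (_ : T + 1 <= _).
  by rewrite /t0 -natr1 lerD2r truncn_le.
have -> : (r^-1 * (1 + ln (A / eps)) + 1) * (n%:R * ln n%:R) =
  n%:R / r * (ln n%:R + ln (A / eps) * ln n%:R) + n%:R * ln n%:R by ring.
apply: lerD.
  by rewrite /T ler_wpM2l ?lerD2l ?ler_peMr // divr_ge0 // ltW.
exact: mulr_ege1.
Qed.
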